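(* Let $n\ge 1$ and let $v_0=\begin{pmatrix}0\\ 1\end{pmatrix}$, $v_i=\begin{pmatrix}a_i\\ b_i\end{pmatrix}\in\mathbb{R}^2$ for $1\le i\le n$, $v_{n+1}=\begin{pmatrix}1\\ 0\end{pmatrix}$. Let $A$ be the symmetric $n\times n$ matrix whose $(i,j)$ entry is $a_ib_j$ for $i\le j$, and assume that $A$ is nonsingular. Set $$m_i=\det(v_i,v_{i+1})\ \ (0\le i\le n),\qquad s_i=-\frac{\det(v_{i-1},v_{i+1})}{m_{i-1}m_i}\ \ (1\le i\le n).$$ Then the inverse of $A$ is the tridiagonal symmetric matrix $$\begin{pmatrix} s_1& m_1^{-1}& 0&0&\dots &0\\ m_1^{-1}& s_2& m_2^{-1}&0& \dots&0\\ 0&m_2^{-1}&s_3& m_3^{-1}&\dots&0\\ \vdots&\ddots&\ddots&\ddots&\ddots&\vdots\\ 0&\dots&0&m_{n-2}^{-1}&s_{n-1}&m_{n-1}^{-1}\\ 0&\dots&0&0&m_{n-1}^{-1}&s_n \end{pmatrix},$$ i.e. the matrix with diagonal entries $s_1,\dots,s_n$, with $(i,i+1)$ and $(i+1,i)$ entries $m_i^{-1}$ for $1\le i\le n-1$, and all other entries $0$.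
   Context: $\det(u,w)$ denotes the determinant of the $2\times 2$ matrix with columns $u,w\in\mathbb{R}^2$. Nonsingularity of $A$ is equivalent to $m_i\neq 0$ for all $0\le i\le n$, so the $s_i$ and $m_i^{-1}$ are well defined. *)

(* Defs.v *)
From HB Require Import structures.
From mathcomp Require Import all_boot all_order all_algebra.
From mathcomp Require Import reals.
Set Implicit Arguments.
Unset Strict Implicit.
Unset Printing Implicit Defensive.
Import Order.TTheory GRing.Theory Num.Theory.
Local Open Scope ring_scope.

(* The families a and b are indexed by nat and only their values at 1, ..., n
   matter.  Matrix rows and columns are numbered from 0 in 'I_n, so the entry
   (i, j) below is the mathematical entry (i.+1, j.+1). *)

Definition vec2 (R : realType) (x y : R) : 'cV[R]_2 :=
  \col_(k < 2) (if k == 0 then x else y).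

Definition det2 (R : realType) (u w : 'cV[R]_2) : R :=
  \det (row_mx u w : 'M[R]_2).

Definition pt (R : realType) (n : nat) (a b : nat -> R) (i : nat) : 'cV[R]_2 :=
  if i == 0%N then vec2 0 1
  else if i == n.+1 then vec2 1 0
  else vec2 (a i) (b i).

Definition Amx (R : realType) (n : nat) (a b : nat -> R) : 'M[R]_n :=
  \matrix_(i < n, j < n)
    (if (i <= j)%N then a i.+1 * b j.+1 else a j.+1 * b i.+1).

Definition mcoef (R : realType) (n : nat) (a b : nat -> R) (i : nat) : R :=
  det2 (pt n a b i) (pt n a b i.+1).

Definition scoef (R : realType) (n : nat) (a b : nat -> R) (i : nat) : R :=
  - (det2 (pt n a b i.-1) (pt n a b i.+1)
     / (mcoef n a b i.-1 * mcoef n a b i)).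

Definition tridiag (R : realType) (n : nat) (s c : nat -> R) : 'M[R]_n :=
  \matrix_(i < n, j < n)
    (if (i == j :> nat) then s i.+1
     else if (i.+1 == j :> nat) then c i.+1
     else if (j.+1 == i :> nat) then c j.+1
     else 0).

(* Main.v *)
(** Put [v_i = (x_i, y_i)]; the entries of [A] are [x_(min i j) * y_(max i j)],
    and this formula extends [A] by a zero row [0] and a zero row [n+1], since
    [x_0 = y_(n+1) = 0].  On either side of the diagonal, a column of [A] is a
    multiple of [y] or of [x], and both sequences are annihilated by the
    tridiagonal operator because of the linear relation between the three plane
    vectors [v_(i-1), v_i, v_(i+1)]; the diagonal contributes [1].  If some
    [m_i] vanished, rows [i] and [i+1] of the extended matrix would be
    dependent with coefficients taken from [v_i] and [v_(i+1)]; for invertible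
    [A] this forces [v_i = 0] or [v_(i+1) = 0], which is impossible because
    [v_0] and [v_(n+1)] are nonzero and any other zero [v_j] gives [A] a zero
    row. *)
Require Import Defs.
From HB Require Import structures.
From mathcomp Require Import all_boot all_order all_algebra.
From mathcomp Require Import reals ring zify.
Set Implicit Arguments.
Unset Strict Implicit.
Unset Printing Implicit Defensive.
Import Order.TTheory GRing.Theory Num.Theory.
Local Open Scope ring_scope.

Definition minmax_entry (F : fieldType) (x y : nat -> F) (i j : nat) : F :=
  if (i <= j)%N then x i * y j else x j * y i.

Definition cross (F : fieldType) (x y : nat -> F) (i j : nat) : F :=
  x i * y j - x j * y i.

(** For [j <= i] the two rows differ only in the factor [y], for [j > i] only in the factor [x]; in
    the latter case the vanishing determinant swaps the factors. *)
Lemma minmax_entry_cross_y (F : fieldType) (x y : nat -> F) (i j : nat) :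
  cross x y i i.+1 = 0 ->
  y i.+1 * minmax_entry x y i j = y i * minmax_entry x y i.+1 j.
Proof.
rewrite /cross /minmax_entry => /eqP; rewrite subr_eq0 => /eqP h.
case: (ltngtP i j) => [ij|ij|<-]; last by ring: h.
- by ring: h.
- by ring.
Qed.

Lemma minmax_entry_cross_x (F : fieldType) (x y : nat -> F) (i j : nat) :
  cross x y i i.+1 = 0 ->
  x i.+1 * minmax_entry x y i j = x i * minmax_entry x y i.+1 j.
Proof.
rewrite /cross /minmax_entry => /eqP; rewrite subr_eq0 => /eqP h.
case: (ltngtP i j) => [ij|ij|<-]; last by ring: h.
- by ring.
- by ring: h.
Qed.

Lemma cross_neq0 (F : fieldType) (n : nat) (x y : nat -> F) (i : nat) :
  x 0%N = 0 -> y 0%N != 0 -> x n.+1 != 0 -> y n.+1 = 0 -> (0 < n)%N ->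
  (\matrix_(i < n, j < n) minmax_entry x y i.+1 j.+1) \in unitmx ->
  (i <= n)%N -> cross x y i i.+1 != 0.
Proof.
move=> x0 y0 xn yn n_gt0 uA le_in; apply/eqP => m0.
set A := (X in X \in unitmx) in uA.
(* [G i] is row [i] of the extended matrix times the inverse of [A]. *)
pose G p (k : 'I_n) := \sum_(j < n) minmax_entry x y p j.+1 * invmx A j k.
have G_in (p k : 'I_n) : G p.+1 k = (p == k)%:R.
  rewrite -[RHS](_ : (A *m invmx A) p k = _); last by rewrite mulmxV // mxE.
  by rewrite mxE; apply: eq_bigr => j _; rewrite mxE.
have G0 k : G 0%N k = 0.
  by apply: big1 => j _; rewrite /minmax_entry /= x0 !mul0r.
have Gn k : G n.+1 k = 0.
  apply: big1 => j _; rewrite /minmax_entry ltnS leqNgt ltn_ord /=.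
  by rewrite yn mulr0 mul0r.
have Gy k : y i.+1 * G i k = y i * G i.+1 k.
  rewrite /G !mulr_sumr; apply: eq_bigr => j _.
  by rewrite !mulrA (minmax_entry_cross_y _ m0).
have Gx k : x i.+1 * G i k = x i * G i.+1 k.
  rewrite /G !mulr_sumr; apply: eq_bigr => j _.
  by rewrite !mulrA (minmax_entry_cross_x _ m0).
case: i le_in m0 Gy Gx => [|i] le_in m0 Gy Gx.
  have := Gy (Ordinal n_gt0).
  rewrite G0 (G_in (Ordinal n_gt0)) eqxx mulr0 mulr1 => /esym/eqP.
  by apply/negP.
have Gii : G i.+1 (Ordinal le_in) = 1 by rewrite (G_in (Ordinal le_in)) eqxx.
have [lt_in|ge_in] := ltnP i.+1 n; last first.
  have en : i.+2 = n.+1 by lia.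
  have := Gx (Ordinal le_in); rewrite Gii en.
  by rewrite Gn mulr0 mulr1 => /eqP; apply/negP.
have Gi1i : G i.+2 (Ordinal le_in) = 0.
  rewrite (G_in (Ordinal lt_in)); case: eqP => // /(congr1 val) /=; lia.
(* In column [i] the two rows read 1 and 0, so both coordinates of the vector at [i.+2] vanish. *)
have := Gy (Ordinal le_in); rewrite Gii Gi1i mulr0 mulr1 => yi.
have := Gx (Ordinal le_in); rewrite Gii Gi1i mulr0 mulr1 => xi.
have : G i.+2 (Ordinal lt_in) = 0.
  apply: big1 => j _; rewrite /minmax_entry yi xi.
  by case: ifP; rewrite ?mulr0 !mul0r.
by rewrite (G_in (Ordinal lt_in)) eqxx => /eqP; rewrite oner_eq0.
Qed.

(** Divide [det(v,w) u - det(u,w) v + det(u,v) w = 0] by [det(u,v) det(v,w)], for three consecutive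
    vectors [u, v, w]. At [k = i.+1] the first entry is [x i * y i.+1] instead of [x i.+1 * y i];
    the excess is [cross x y i i.+1], whence the 1. *)
Lemma minmax_entry_recurrence (F : fieldType) (x y : nat -> F) (i k : nat) :
  cross x y i i.+1 != 0 -> cross x y i.+1 i.+2 != 0 ->
  (cross x y i i.+1)^-1 * minmax_entry x y i k
  - cross x y i i.+2 / (cross x y i i.+1 * cross x y i.+1 i.+2)
    * minmax_entry x y i.+1 k
  + (cross x y i.+1 i.+2)^-1 * minmax_entry x y i.+2 k = (i.+1 == k)%:R.
Proof.
rewrite /cross /minmax_entry => m0 m1.
have [lt_ki|lt_ik|->] := ltngtP k i.+1; rewrite ?mulr0n ?mulr1n.
- have [ik|_] := leqP i k; last by field; rewrite m0 m1.
  have -> : k = i by lia.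
  by field; rewrite m0 m1.
- have -> : (i <= k)%N by lia.
  by field; rewrite m0 m1.
- rewrite leqnSn.
  by field; rewrite m0 m1.
Qed.

(** The matrix contains neither [c 0] nor [c n]; the zeros of [f] at both ends let the first and
    last rows share the general formula. *)
Lemma tridiag_mul_entry (R : realType) (n : nat) (s c f : nat -> R) (i : 'I_n) :
  f 0%N = 0 -> f n.+1 = 0 ->
  \sum_(j < n) tridiag n s c i j * f j.+1 =
  c i * f i + s i.+1 * f i.+1 + c i.+1 * f i.+2.
Proof.
move=> f0 fn.
have E (j : 'I_n) : tridiag n s c i j * f j.+1 =
    (if j.+1 == i :> nat then c j.+1 * f j.+1 else 0)
    + (if j == i :> nat then s j.+1 * f j.+1 else 0)
    + (if j == i.+1 :> nat then c j * f j.+1 else 0).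
  rewrite mxE (eq_sym (j : nat) i) (eq_sym (j : nat) i.+1).
  case: (i =P j :> nat) => [->|?].
    by rewrite !gtn_eqF ?ltn_eqF // add0r addr0.
  case: (i.+1 =P j :> nat) => [<-|?].
    by rewrite gtn_eqF ?add0r //; lia.
  by case: ifP; rewrite ?mul0r !addr0.
rewrite (eq_bigr _ (fun j _ => E j)) !big_split /=; congr (_ + _ + _).
- case: i {E} => -[|p] lt_pn /=; first by rewrite big1 // f0 mulr0.
  under eq_bigr do rewrite eqSS.
  rewrite -big_mkcond (big_ord1_eq _ (fun j => c j.+1 * f j.+1)).
  by rewrite (ltnW lt_pn).
- by rewrite -big_mkcond (big_ord1_eq _ (fun j => s j.+1 * f j.+1)) ltn_ord.
- rewrite -big_mkcond (big_ord1_eq _ (fun j => c j * f j.+1)).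
  case: ltnP => // le_ni.
  have -> : i.+2 = n.+1 by have := ltn_ord i; lia.
  by rewrite fn mulr0.
Qed.

Lemma det2E (R : realType) (u w : 'cV[R]_2) :
  det2 u w = u 0 0 * w 1 0 - w 0 0 * u 1 0.
Proof.
rewrite /det2.
have -> : row_mx u w = \matrix_(i < 2, j < 2) (if j == 0 then u i 0 else w i 0).
  apply/matrixP => i j; rewrite !mxE.
  by case: splitP => k; rewrite (ord1 k) -val_eqE /= => ->.
rewrite (expand_det_row _ 0) big_ord_recl big_ord1 /cofactor !det_mx11 !mxE /=.
have -> : lift 0 0 = 1 :> 'I_2 by apply: val_inj.
by rewrite expr0 expr1 mul1r mulN1r mulrN.
Qed.

Theorem proposition3p1 (R : realType) (n : nat) (a b : nat -> R)
  (hn : (1 <= n)%N) (hA : Amx n a b \in unitmx) :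
  invmx (Amx n a b) = tridiag n (scoef n a b) (fun i => (mcoef n a b i)^-1).
Proof.
pose x i := pt n a b i 0 0; pose y i := pt n a b i 1 0.
have x0 : x 0%N = 0 by rewrite /x /pt /vec2 /= mxE.
have y0 : y 0%N = 1 by rewrite /y /pt /vec2 /= mxE.
have xn : x n.+1 = 1 by rewrite /x /pt /vec2 /= eqxx mxE.
have yn : y n.+1 = 0 by rewrite /y /pt /vec2 /= eqxx mxE.
have xE (i : 'I_n) : x i.+1 = a i.+1.
  by rewrite /x /pt /vec2 /= eqSS ltn_eqF ?ltn_ord // mxE.
have yE (i : 'I_n) : y i.+1 = b i.+1.
  by rewrite /y /pt /vec2 /= eqSS ltn_eqF ?ltn_ord // mxE.
have AE : Amx n a b = \matrix_(i < n, j < n) minmax_entry x y i.+1 j.+1.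
  by apply/matrixP => i j; rewrite !mxE /minmax_entry ltnS !xE !yE.
have mE i : mcoef n a b i = cross x y i i.+1 by rewrite /mcoef det2E.
have m_neq0 i : (i <= n)%N -> cross x y i i.+1 != 0.
  by apply: cross_neq0; rewrite -?AE // ?y0 ?xn oner_neq0.
(* A left inverse suffices, as [A] is invertible. *)
suff TA : tridiag n (scoef n a b) (fun i => (mcoef n a b i)^-1)
            *m Amx n a b = 1%:M.
  by rewrite -[RHS](mulmxK hA) TA mul1mx.
apply/matrixP => i k; rewrite AE !mxE.
under eq_bigr do rewrite [X in _ * X]mxE.
(* Here [f] is column [k] of the extended matrix. *)
rewrite (@tridiag_mul_entry _ _ _ _ (fun j : nat => minmax_entry x y j k.+1)).
- rewrite /scoef !mE det2E mulNr.
  by rewrite minmax_entry_recurrence ?m_neq0 // ltnW.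
- by rewrite /minmax_entry /= x0 mul0r.
- by rewrite /minmax_entry ltnS leqNgt ltn_ord /= yn mulr0.
Qed.
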